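(* Let $X$ be an infinite Hausdorff topological space. If $X$ is totally paracompact and $X$ has a dense subset that is $\sigma$-compact (i.e. a dense subset of the form $\bigcup_{n\in\omega} C_n$ with each $C_n$ compact), then $X$ is Menger.
   Context: A space $X$ is totally paracompact if every open base of $X$ contains a locally finite cover of $X$ (i.e. every base $\mathcal{B}$ of the topology has a subfamily $\mathcal{B}'\subseteq\mathcal{B}$ that covers $X$ and is locally finite in $X$). A space $X$ is Menger if for every sequence $\mathcal{U}_0,\mathcal{U}_1,\dots$ of open covers of $X$ there are finite sets $\mathcal{F}_0\subseteq\mathcal{U}_0,\mathcal{F}_1\subseteq\mathcal{U}_1,\dots$ such that $\bigcup_{n\in\omega}\mathcal{F}_n$ is a cover of $X$. *)

(* Defs.v *)
From HB Require Import structures.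
From mathcomp Require Import all_boot.
From mathcomp Require Import classical_sets cardinality topology.

Set Implicit Arguments.
Unset Strict Implicit.
Unset Printing Implicit Defensive.

Local Open Scope classical_set_scope.

Section Covering_properties.
Variable X : topologicalType.
Implicit Types (U V B F : set (set X)) (S : set X).

Definition covers U := \bigcup_(A in U) A = [set: X].

Definition open_cover U := U `<=` open /\ covers U.

Definition locally_finite U := forall x : X,
  exists2 N : set X, nbhs x N & finite_set [set A | U A /\ A `&` N !=set0].

Definition totally_paracompact := forall B, basis B ->
  exists V, [/\ V `<=` B, covers V & locally_finite V].

Definition sigma_compact S := exists2 C : nat -> set X,
  (forall n, compact (C n)) & S = \bigcup_n C n.

Definition menger := forall U : nat -> set (set X),
  (forall n, open_cover (U n)) ->
  exists F : nat -> set (set X),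
    (forall n, F n `<=` U n /\ finite_set (F n)) /\ covers (\bigcup_n F n).

End Covering_properties.

Arguments totally_paracompact : clear implicits.
Arguments menger : clear implicits.

(* Main.v *)
Require Import Defs.
From mathcomp Require Import all_boot.
From mathcomp Require Import boolp classical_sets cardinality topology.

(** Let [C n] be compact sets with dense union and [U n] open covers.  Call an
    open set [A] of type [n] if it meets [C n] and lies in the union of two
    members of [U n].  The sets that have some type form a base: an open set
    [O] containing [x] meets some [C n] at a point [c], and [O `&` (U1 `|` U2)]
    is of type [n] whenever [U1], [U2] in [U n] contain [x] and [c].  In a
    locally finite subcover only finitely many sets meet the compact set [C n],
    so the sets of type [n] in it are covered by finitely many members of
    [U n]. *)

Local Open Scope classical_set_scope.

(** Compactness enters in its near-covering form, along the filter [F] of families containing all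
    but finitely many members of [V]: each point of [K] has a neighbourhood that almost all members
    miss, so almost all members miss [K] itself. *)
Lemma locally_finite_compact (X : topologicalType) (V : set (set X))
    (K : set X) :
  locally_finite V -> compact K -> finite_set [set A | V A /\ A `&` K !=set0].
Proof.
move=> Vlf /compact_near_coveringP Kco.
pose F : set_system (set X) := [set P | finite_set (V `\` P)].
have FF : Filter F.
  split=> [|P Q FP FQ|P Q PQ]; rewrite /F /=.
  - by rewrite setDT; exact: finite_set0.
  - by rewrite setDIr finite_setU.
  - by apply: sub_finite_set => A [VA nQA]; split=> // /PQ.
have /(Kco _ F (fun A x => ~ A x) FF) : forall x, K x -> \near x & F, ~ F x.
  move=> x _; have [N xN Nfin] := Vlf x.
  exists (N, [set A | ~ (A `&` N !=set0)]) => /=; last first.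
    by move=> [y A] [/= Ny nAN] Ay; apply: nAN; exists y.
  split=> //; apply: sub_finite_set Nfin.
  by move=> A [VA /contrapT].
apply: sub_finite_set => A [VA [x [Ax Kx]]]; split=> // KA.
exact: KA x Kx Ax.
Qed.

Definition in_two_members (X : topologicalType) (U : set (set X)) (A : set X)
    (p : set X * set X) :=
  [/\ U p.1, U p.2 & A `<=` p.1 `|` p.2].

Definition typed_sets (X : topologicalType) (C : nat -> set X)
    (U : nat -> set (set X)) : set (set X) :=
  [set A | open A /\
    exists n, A `&` C n !=set0 /\ exists p, in_two_members X (U n) A p].

Lemma basis_typed_sets (X : topologicalType) (C : nat -> set X)
    (U : nat -> set (set X)) :
  dense (\bigcup_n C n) -> (forall n, open_cover (U n)) ->
  basis (typed_sets X C U).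
Proof.
move=> Cdense Ucov; split=> [A []//|x M].
rewrite nbhsE => -[O [Oop Ox] OM].
have [c [Oc [n _ Cnc]]] := Cdense O (ex_intro _ x Ox) Oop.
have [Uop Un] := Ucov n.
have UnP y : exists2 W, U n W & W y.
  by have [W ? ?] : (\bigcup_(A in U n) A) y; [rewrite Un | exists W].
have [[U1 U1n U1x] [U2 U2n U2c]] := (UnP x, UnP c).
exists (O `&` (U1 `|` U2)); last by move=> y [/OM].
split; last by split=> //; left.
split; first by apply: openI => //; apply: openU; exact: Uop.
exists n; split; first by exists c; split=> //; split=> //; right.
by exists (U1, U2); split=> // y [].
Qed.

Theorem theorem2p1 (X : topologicalType)
    (Xinf : infinite_set [set: X]) (Xhaus : hausdorff_space X)
    (Xtp : totally_paracompact X)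
    (Xsc : exists2 S : set X, dense S & sigma_compact S) :
  menger X.
Proof.
have [S + [C Cco SE]] := Xsc; rewrite {}SE => Cdense.
move=> U Ucov.
have [V [VB Vcov Vlf]] := Xtp _ (basis_typed_sets X C U Cdense Ucov).
(* The choice depends on [n] as well as [A], since a set may have several types, each with its own
   cover. The value [(set0, set0)] is a dummy for pairs where no two members suffice. *)
have /choice[p pP] : forall nA : nat * set X, exists p,
    (exists q, in_two_members X (U nA.1) nA.2 q) ->
    in_two_members X (U nA.1) nA.2 p.
  move=> nA; case: (pselect (exists q, in_two_members X (U nA.1) nA.2 q)).
  - by case=> q; exists q.
  - by exists (set0, set0).
pose T n := [set A | (V A /\ A `&` C n !=set0) /\
                     exists q, in_two_members X (U n) A q].
exists (fun n => \bigcup_(A in T n) [set (p (n, A)).1; (p (n, A)).2]).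
split=> [n|].
- split=> [W [A [_ /(pP (n, A))[p1 p2 _]] [->|->]]//|].
  (* Each of the finitely many sets in [T n] contributes at most two members of [U n]. *)
  apply: bigcup_finite => [|A _]; last exact: finite_set2.
  apply: sub_finite_set (locally_finite_compact _ _ _ Vlf (Cco n)).
  by move=> A [].
- rewrite /covers -subTset => x _.
  have [A VA Ax] : (\bigcup_(A in V) A) x by rewrite Vcov.
  have [_ [n [ACn Aq]]] := VB _ VA.
  have TA : T n A by [].
  have [_ _ /(_ x Ax)[px|px]] := pP (n, A) Aq.
  + by exists (p (n, A)).1 => //; exists n => //; exists A => //; left.
  + by exists (p (n, A)).2 => //; exists n => //; exists A => //; right.
Qed.
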